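(* For every $n\ge 3$ there is an irreducible subcube partition of $\{0,1\}^n$ containing exactly $2^{n-2}$ points (subcubes of dimension $0$).
   Context: Subcubes of $\{0,1\}^n$ are sets fixing some coordinates, identified with words in $\{0,1,*\}^n$; the dimension is the number of $*$s, and a point is a $0$-dimensional subcube. A subcube partition is a partition of $\{0,1\}^n$ into subcubes; it is irreducible if no subset $G$ with $1<|G|<|F|$ has a union that is a subcube. *)

(* Defs.v *)
From mathcomp Require Import all_boot.

Set Implicit Arguments.
Unset Strict Implicit.
Unset Printing Implicit Defensive.

Definition point (n : nat) := {ffun 'I_n -> bool}.

(* Words in {0,1,*}^n: [Some b] fixes a coordinate to [b], [None] is a star. *)
Definition word (n : nat) := {ffun 'I_n -> option bool}.

Definition subcube n (w : word n) : {set point n} :=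
  [set x : point n | [forall i, (w i == None) || (w i == Some (x i))]].

Definition is_subcube n (A : {set point n}) : Prop :=
  exists w : word n, A = subcube w.

Definition dim n (w : word n) : nat := #|[set i | w i == None]|.

(* Distinct words denote distinct subcubes, so a family of subcubes can be
   given as a set of words. *)
Lemma subcube_inj n : injective (@subcube n).
Proof.
move=> v w eq_vw.
pose pt (u : word n) (b : bool) : point n := [ffun i => odflt b (u i)].
have ptP u b : pt u b \in subcube u.
  by rewrite inE; apply/forallP=> i; rewrite ffunE; case: (u i) => //= c.
apply/ffunP=> i.
have Hv b : (w i == None) || (w i == Some (odflt b (v i))).
  by have := ptP v b; rewrite eq_vw inE => /forallP/(_ i); rewrite ffunE.
have Hw b : (v i == None) || (v i == Some (odflt b (w i))).
  by have := ptP w b; rewrite -eq_vw inE => /forallP/(_ i); rewrite ffunE.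
move: (Hv true) (Hv false) (Hw true) (Hw false).
by case: (v i) => [[]|]; case: (w i) => [[]|].
Qed.

Definition subcube_partition n (F : {set word n}) : Prop :=
  partition [set subcube w | w in F] [set: point n].

Definition irreducible n (F : {set word n}) : Prop :=
  forall G : {set word n}, G \subset F -> 1 < #|G| < #|F| ->
    ~ is_subcube (\bigcup_(w in G) subcube w).

(* Main.v *)
Require Import Defs.
From mathcomp Require Import all_boot.

Set Implicit Arguments.
Unset Strict Implicit.
Unset Printing Implicit Defensive.

(** If two irreducible partitions [F0] and [F1] of the n-cube have a word in
    common, stacking them along a new coordinate and gluing each common word w
    into *w gives an irreducible partition of the (n+1)-cube: a union that is a
    subcube restricts in both halves to a single word or to the whole half.  If
    [F0] and [F1] share no point, the numbers of points add up.  Stacking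
    ([F0], [F1]) and ([F1], [F0]) gives a pair with the same properties, and for
    n = 3 one starts from [{01*, *01, 1*0, 000, 111}] and its image under the
    flip of the last coordinate, which share only 01*. *)

(** * Pointwise forms of partition and irreducibility *)

Definition covered n (G : {set word n}) (x : point n) : bool :=
  [exists w in G, x \in subcube w].

Lemma coveredP n (G : {set word n}) x :
  reflect (exists2 w, w \in G & x \in subcube w) (covered G x).
Proof. by apply: (iffP exists_inP) => -[w wG xw]; exists w. Qed.

Lemma mem_subcube n (w : word n) x :
  (x \in subcube w) = [forall i, (w i == None) || (w i == Some (x i))].
Proof. by rewrite inE. Qed.

Lemma subcube_nonempty n (w : word n) : exists x, x \in subcube w.
Proof.
exists [ffun i => odflt false (w i)]; rewrite mem_subcube.
by apply/forallP=> i; rewrite ffunE; case: (w i) => //= b; rewrite eqxx.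
Qed.

Lemma dim_eq0 n (w : word n) : (dim w == 0) = [forall i, w i != None].
Proof.
rewrite /dim cards_eq0; apply/eqP/forallP => [w0 i|wN].
  by apply/negP=> wi; have := in_set0 i; rewrite -w0 inE wi.
by apply/setP=> i; rewrite !inE (negPf (wN i)).
Qed.

(** A form of [subcube_partition] that speaks of words and points only, which suits restriction to a
    half of the cube. *)
Definition exact_cover n (F : {set word n}) : Prop :=
  (forall x, covered F x) /\
  (forall x, {in F &, forall v w, x \in subcube v -> x \in subcube w -> v = w}).

Lemma exact_cover_partition n (F : {set word n}) :
  exact_cover F -> subcube_partition F.
Proof.
case=> covF uniF; apply/and3P; split.
- apply/eqP/setP=> x; rewrite inE; have /coveredP[w wF xw] := covF x.
  by apply/bigcupP; exists (subcube w) => //; apply: imset_f.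
- apply/trivIsetP=> _ _ /imsetP[v vF ->] /imsetP[w wF ->] neq_vw.
  rewrite -setI_eq0; apply: contraR neq_vw => /set0Pn[x /setIP[xv xw]].
  by rewrite (uniF x v w).
- apply/imsetP=> -[w _ w0]; have [x] := subcube_nonempty w.
  by rewrite -w0 inE.
Qed.

(** Positive form of irreducibility: the cardinality bounds become two trivial outcomes. The empty
    [G] never arises, since a subcube is nonempty. *)
Definition indecomposable n (F : {set word n}) : Prop :=
  forall (G : {set word n}) (v : word n), G \subset F ->
    (forall x, (x \in subcube v) = covered G x) ->
    G = F \/ exists w, G = [set w].

Lemma indecomposable_irreducible n (F : {set word n}) :
  indecomposable F -> irreducible F.
Proof.
move=> indF G sGF /andP[G1 GF] [v Gv].
have [x||[w Gw]] := indF G v sGF; last by move: G1; rewrite Gw cards1.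
  by rewrite -Gv; apply/bigcupP/coveredP.
by move=> eGF; move: GF; rewrite eGF ltnn.
Qed.

(** Each [w] in [F] has a point, and the word of [G] through that point must be [w] by
    uniqueness. *)
Lemma exact_cover_sub n (F G : {set word n}) :
  exact_cover F -> G \subset F -> (forall x, covered G x) -> G = F.
Proof.
move=> [_ uniF] sGF covG; apply/eqP; rewrite eqEsubset sGF.
apply/subsetP=> w wF; have [x xw] := subcube_nonempty w.
have /coveredP[v vG xv] := covG x.
by rewrite (uniF x w v) // (subsetP sGF).
Qed.

(** * Splitting off the first coordinate of words and points *)

Definition wcons n (c : option bool) (w : word n) : word n.+1 :=
  [ffun i => oapp w c (unlift ord0 i)].

Definition pcons n (b : bool) (x : point n) : point n.+1 :=
  [ffun i => oapp x b (unlift ord0 i)].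

Definition wtail n (v : word n.+1) : word n := [ffun i => v (lift ord0 i)].

Lemma wcons0 n c (w : word n) : wcons c w ord0 = c.
Proof. by rewrite ffunE unlift_none. Qed.

Lemma wconsK n c (w : word n) : wtail (wcons c w) = w.
Proof. by apply/ffunP=> i; rewrite !ffunE liftK. Qed.

Lemma wcons_tail n (v : word n.+1) : wcons (v ord0) (wtail v) = v.
Proof.
by apply/ffunP=> i; rewrite !ffunE; case: unliftP => [j|] -> //=; rewrite ffunE.
Qed.

Lemma pconsP n (x : point n.+1) : exists b y, x = pcons b y.
Proof.
exists (x ord0), [ffun i => x (lift ord0 i)].
by apply/ffunP=> i; rewrite !ffunE; case: unliftP => [j|] -> //=; rewrite ffunE.
Qed.

Lemma wconsP n (v : word n.+1) : exists c w, v = wcons c w.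
Proof. by exists (v ord0), (wtail v); rewrite wcons_tail. Qed.

Lemma wcons_inj n (c c' : option bool) (w w' : word n) :
  wcons c w = wcons c' w' -> c = c' /\ w = w'.
Proof.
move=> e; split; first by rewrite -(wcons0 c w) e wcons0.
by rewrite -(wconsK c w) e wconsK.
Qed.

Lemma forall_ordS n (P : pred 'I_n.+1) :
  [forall i, P i] = P ord0 && [forall i, P (lift ord0 i)].
Proof.
apply/forallP/andP => [Pi|[P0 /forallP PS] i]; first by split=> //; apply/forallP.
by case: (unliftP ord0 i) => [j|] ->.
Qed.

Lemma mem_subcube_cons n c (w : word n) b x :
  (pcons b x \in subcube (wcons c w)) =
  ((c == None) || (c == Some b)) && (x \in subcube w).
Proof.
rewrite !mem_subcube forall_ordS !ffunE unlift_none /=; congr (_ && _).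
by apply: eq_forallb => i; rewrite !ffunE liftK.
Qed.

Lemma dim_cons_eq0 n c (w : word n) :
  (dim (wcons c w) == 0) = (c != None) && (dim w == 0).
Proof.
rewrite !dim_eq0 forall_ordS wcons0; congr (_ && _).
by apply: eq_forallb => i; rewrite ffunE liftK.
Qed.

(** * Stacking two families and slicing back *)

(* Stacks [F false] and [F true] along a new coordinate, gluing the two copies
   of each common word into a single word starting with a star. *)
Definition merge n (F : bool -> {set word n}) : {set word n.+1} :=
  [set v : word n.+1 | if v ord0 is Some b then wtail v \in F b :\: F (~~ b)
           else wtail v \in F false :&: F true].

Lemma mem_merge n (F : bool -> {set word n}) c w :
  (wcons c w \in merge F) =
  if c is Some b then (w \in F b) && (w \notin F (~~ b))
  else (w \in F false) && (w \in F true).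
Proof. by rewrite inE wcons0 wconsK; case: c => [b|]; rewrite !inE // andbC. Qed.

(** Traces of [G] on the half with first coordinate [b]; a word starting with a star leaves a trace
    on both halves. *)
Definition slice n (b : bool) (G : {set word n.+1}) : {set word n} :=
  [set w | (wcons (Some b) w \in G) || (wcons None w \in G)].

Lemma mem_slice n b (G : {set word n.+1}) w :
  (w \in slice b G) = (wcons (Some b) w \in G) || (wcons None w \in G).
Proof. by rewrite inE. Qed.

Lemma slice_sub n (F : bool -> {set word n}) (G : {set word n.+1}) b :
  G \subset merge F -> slice b G \subset F b.
Proof.
move=> /subsetP sG; apply/subsetP=> w; rewrite mem_slice => /orP[] /sG.
  by rewrite mem_merge => /andP[].
by rewrite mem_merge => /andP[]; case: b.
Qed.

Lemma covered_slice n (G : {set word n.+1}) b x :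
  covered (slice b G) x = covered G (pcons b x).
Proof.
apply/coveredP/coveredP => [[w]|[v]].
  by rewrite mem_slice => /orP[] wG xw; eexists; try exact: wG;
    rewrite mem_subcube_cons xw // eqxx orbT.
have [c [w ->]] := wconsP v; rewrite mem_subcube_cons => vG /andP[cb xw].
exists w => //; rewrite mem_slice; case/orP: cb => /eqP ec; rewrite ec in vG.
  by rewrite vG orbT.
by rewrite vG.
Qed.

Section Merge.

Variables (n : nat) (F : bool -> {set word n}).
Hypothesis exF : forall b, exact_cover (F b).

Lemma slice_merge b : slice b (merge F) = F b.
Proof.
apply/setP=> w; rewrite mem_slice !mem_merge.
by case: b; case: (w \in F true); case: (w \in F false).
Qed.

(** On each half the traces form [F b], which gives covering and equality of tails; only the first
    letters remain to be compared. *)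
Lemma exact_cover_merge : exact_cover (merge F).
Proof.
split=> [x|x v w].
  have [b [y ->]] := pconsP x; rewrite -covered_slice slice_merge.
  by case: (exF b).
have [b [y ->]] := pconsP x.
have [c [v' ->]] := wconsP v; have [d [w' ->]] := wconsP w.
rewrite !mem_subcube_cons => vF wF /andP[cb yv] /andP[db yw].
have inslice c' u : wcons c' u \in merge F -> (c' == None) || (c' == Some b) ->
    u \in F b.
  by rewrite -(slice_merge b) mem_slice => + /orP[] /eqP cE; rewrite cE => ->; rewrite ?orbT.
have evw : v' = w'.
  by case: (exF b) => _ /(_ y v' w' (inslice _ _ vF cb) (inslice _ _ wF db)); apply.
(* A fixed first letter requires a tail outside the opposite family, whereas a glued tail lies in
   both. *)
have glued : wcons None w' \in merge F -> wcons (Some b) w' \notin merge F.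
  by rewrite !mem_merge => /andP[w0 w1]; case: (b); rewrite /= ?w0 ?w1 andbF.
rewrite evw in vF *.
case/orP: cb vF => /eqP->; case/orP: db wF => /eqP-> // wF vF.
  by have := glued vF; rewrite wF.
by have := glued wF; rewrite vF.
Qed.

Hypothesis indF : forall b, indecomposable (F b).
Hypothesis sharedF : exists w, w \in F false :&: F true.

(** Inside [merge F] the slices determine the first letter: a tail seen in both slices lies in both
    families, so it can only come from a glued word. *)
Lemma slice_inj (G H : {set word n.+1}) :
  G \subset merge F -> H \subset merge F ->
  (forall b, slice b G = slice b H) -> G = H.
Proof.
have half (A B : {set word n.+1}) : A \subset merge F -> B \subset merge F ->
    (forall b, slice b A = slice b B) -> A \subset B.
  move=> /subsetP sA /subsetP sB eAB; apply/subsetP=> v vA.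
  have := sA _ vA; have [c [w ev]] := wconsP v; rewrite ev in vA *.
  have wB b : (c == None) || (c == Some b) -> w \in slice b B.
    by rewrite -eAB mem_slice => /orP[] /eqP cE; rewrite -cE vA ?orbT.
  rewrite mem_merge; case: c vA wB {ev} => [b|] vA wB.
    move=> /andP[_ wN]; have := wB b (eqxx _).
    rewrite mem_slice => /orP[//|/sB]; rewrite mem_merge => /andP[w0 w1].
    by case: b wN {vA wB}; rewrite /= ?w0 ?w1.
  move=> /andP[w0 w1]; have := wB false isT.
  rewrite mem_slice => /orP[/sB|//]; by rewrite mem_merge /= w1 andbF.
by move=> sG sH eGH; apply/eqP; rewrite eqEsubset; apply/andP; split; apply: half.
Qed.

Lemma slice_set1 b c (w : word n) :
  slice b [set wcons c w] = if (c == None) || (c == Some b) then [set w] else set0.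
Proof.
apply/setP=> u; rewrite mem_slice !in_set1.
have wE c' : (wcons c' u == wcons c w) = (c == c') && (u == w).
  by apply/eqP/andP => [/wcons_inj[-> ->]|[/eqP-> /eqP->]].
rewrite !wE; case: (c == None); case: (c == Some b); rewrite ?inE //=;
by case: (u == w).
Qed.

(** The first letter [c] of the subcube decides the case: a star makes both slices of [G] cover the
    same [u], and a fixed letter confines [G] to one half. *)
Lemma indecomposable_merge : indecomposable (merge F).
Proof.
move=> G v sG; have [c [u ->]] := wconsP v => covG.
have slG b x : ((c == None) || (c == Some b)) && (x \in subcube u) =
    covered (slice b G) x by rewrite covered_slice -covG mem_subcube_cons.
have sSG b := slice_sub b sG.
case: c slG {covG} => [b|] slG; last first.
  have coveru b x : (x \in subcube u) = covered (slice b G) x by rewrite -slG.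
  (* If one slice is full, then [u] is the whole smaller cube, so the other slice is full too. *)
  have [[b Gb]|nG] : (exists b, slice b G = F b) \/ (forall b, slice b G <> F b).
    case: (slice false G =P F false) => [|nf]; first by left; exists false.
    case: (slice true G =P F true) => [|nt]; first by left; exists true.
    by right; case.
  - left; apply: slice_inj => // d; rewrite slice_merge.
    apply: exact_cover_sub => // x; rewrite -coveru (coveru b) Gb.
    by case: (exF b).
  (* With neither slice full, both reduce to [u] itself, which is therefore shared and glued. *)
  - have Gu b : slice b G = [set u].
      have [|/nG//|[w Gw]] := indF (sSG b) (v := u); first exact: coveru.
      rewrite Gw; congr [set _]; apply: subcube_inj; apply/setP=> x.
      rewrite (coveru b) Gw.
      apply/idP/coveredP => [xw|[w' /set1P->] //].
      by exists w; first exact: set11.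
    right; exists (wcons None u); apply: slice_inj => // [|b].
      rewrite sub1set mem_merge; apply/andP; split.
        by apply: (subsetP (sSG false)); rewrite Gu set11.
      by apply: (subsetP (sSG true)); rewrite Gu set11.
    by rewrite slice_set1 Gu.
have Gnb : slice (~~ b) G = set0.
  apply/setP=> w; rewrite in_set0; apply/negP=> wG; have [x xw] := subcube_nonempty w.
  have : covered (slice (~~ b) G) x by apply/coveredP; exists w.
  by rewrite -slG /=; case: b {slG wG}.
have [|Gb|[w Gw]] := indF (sSG b) (v := u).
- by move=> x; rewrite -slG eqxx.
(* A full slice would contain the shared word [s], which occurs only glued and so would leave a
   trace on the opposite half, where [G] has none. *)
- have [s /setIP[s0 s1]] := sharedF.
  have : s \in slice b G by rewrite Gb; case: b {slG Gnb Gb}.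
  rewrite mem_slice => /orP[/(subsetP sG)|sG'].
    by rewrite mem_merge; case: b {slG Gnb Gb}; rewrite /= ?s0 ?s1 andbF.
  by have := in_set0 s; rewrite -Gnb mem_slice sG' orbT.
right; exists (wcons (Some b) w).
have wG : wcons (Some b) w \in G.
  have : w \in slice b G by rewrite Gw set11.
  rewrite mem_slice => /orP[//|wG].
  by have := in_set0 w; rewrite -Gnb mem_slice wG orbT.
apply: slice_inj => // [|d]; first by rewrite sub1set (subsetP sG).
rewrite slice_set1 /=; case: (b =P d) => [<-|nbd]; first by rewrite eqxx.
have -> : d = ~~ b by case: (b) (d) nbd => [] [].
by rewrite Gnb; case: (b).
Qed.

Hypothesis pointsF : {in F false :&: F true, forall w, dim w != 0}.

(** Gluing destroys no point, as shared words are not points, and creates none, as glued words have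
    a star. The points thus form two disjoint prefixed copies. *)
Lemma card_points_merge m :
  (forall b, #|[set w in F b | dim w == 0]| = m) ->
  #|[set w in merge F | dim w == 0]| = 2 * m.
Proof.
move=> cF; pose P b := [set wcons (Some b) w | w in [set w in F b | dim w == 0]].
have cP b : #|P b| = m.
  by rewrite card_imset ?cF // => w w' /wcons_inj[].
have -> : [set w in merge F | dim w == 0] = P false :|: P true.
  apply/setP=> v; have [c [w ->]] := wconsP v.
  have memP b : (wcons c w \in P b) = [&& c == Some b, w \in F b & dim w == 0].
    apply/imsetP/and3P => [[w'] + /wcons_inj[-> ->]|[/eqP-> wF w0]].
      by rewrite inE => /andP[].
    by exists w; rewrite // inE wF.
  rewrite in_setU inE mem_merge dim_cons_eq0 !memP.
  have := @pointsF w; rewrite in_setI.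
  case: c {memP} => [[]|] /=; rewrite ?andbF //;
  case: (w \in F true); case: (w \in F false); case: (dim w == 0) => //= /(_ isT) //.
rewrite cardsU !cP; have -> : P false :&: P true = set0.
  apply/setP=> v; rewrite !inE; apply/negP.
  by case/andP=> /imsetP[w _ ->] /imsetP[w' _ /wcons_inj[]].
by rewrite cards0 subn0 mul2n addnn.
Qed.

End Merge.

(** * The invariant of the induction on the dimension *)

Definition good_pair n (m : nat) (F : bool -> {set word n}) : Prop :=
  [/\ forall b, exact_cover (F b),
      forall b, indecomposable (F b),
      forall b, #|[set w in F b | dim w == 0]| = m,
      {in F false :&: F true, forall w, dim w != 0} &
      exists w, w \in F false :&: F true].

(** A word with fixed first letter cannot be in both stackings, since they demand opposite
    memberships of its tail. Common words thus start with a star and are not points; gluing an old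
    shared word provides one. *)
Lemma good_pair_merge n m (F : bool -> {set word n}) :
  good_pair m F -> good_pair (2 * m) (fun b => merge (fun d => F (b (+) d))).
Proof.
case=> exF indF cF ptF shF.
have FI b : F (b (+) false) :&: F (b (+) true) = F false :&: F true.
  by case: b => //=; rewrite setIC.
split=> [b|b|b|v|].
- exact: exact_cover_merge.
- by apply: indecomposable_merge => //; rewrite FI.
- by apply: card_points_merge => //; rewrite FI.
- have [c [w ->]] := wconsP v; rewrite inE !mem_merge dim_cons_eq0.
  by case: c => [[]|] //= /andP[/andP[_ /negPf->]].
case: shF => w /setIP[w0 w1]; exists (wcons None w).
by rewrite inE !mem_merge /= w0 w1.
Qed.

(** * The base pair in dimension three *)

Definition word3 (a b c : option bool) : word 3 :=
  wcons a (wcons b (wcons c [ffun=> None])).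

(** Three edges, one in each direction, and two antipodal points; [b] encodes the flip of the last
    coordinate. *)
Definition base (b : bool) : {set word 3} :=
  [set word3 (Some false) (Some true) None;
       word3 None (Some false) (Some (~~ b));
       word3 (Some true) None (Some b);
       word3 (Some false) (Some false) (Some b);
       word3 (Some true) (Some true) (Some (~~ b))].

Lemma word3P (v : word 3) : exists a b c, v = word3 a b c.
Proof.
have [a [v1 ->]] := wconsP v; have [b [v2 ->]] := wconsP v1.
have [c [v3 ->]] := wconsP v2; exists a, b, c; rewrite /word3.
by do 3 congr (wcons _ _); apply/ffunP=> -[].
Qed.

Lemma eq_word3 a b c a' b' c' :
  (word3 a b c == word3 a' b' c') = [&& a == a', b == b' & c == c'].
Proof.
apply/eqP/and3P => [/wcons_inj[-> /wcons_inj[-> /wcons_inj[-> _]]] //|].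
by case=> /eqP-> /eqP-> /eqP->.
Qed.

Definition point3 (a b c : bool) : point 3 :=
  pcons a (pcons b (pcons c [ffun=> false])).

Lemma point3P (x : point 3) : exists a b c, x = point3 a b c.
Proof.
have [a [x1 ->]] := pconsP x; have [b [x2 ->]] := pconsP x1.
have [c [x3 ->]] := pconsP x2; exists a, b, c; rewrite /point3.
by do 3 congr (pcons _ _); apply/ffunP=> -[].
Qed.

Lemma mem_word3 a b c p q r :
  (point3 a b c \in subcube (word3 p q r)) =
  [&& (p == None) || (p == Some a), (q == None) || (q == Some b) &
      (r == None) || (r == Some c)].
Proof.
rewrite !mem_subcube_cons; have -> : [ffun=> false] \in @subcube 0 [ffun=> None].
  by rewrite mem_subcube; apply/forallP=> i; rewrite !ffunE.
by rewrite andbT.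
Qed.

Lemma dim_word3 a b c :
  (dim (word3 a b c) == 0) = [&& a != None, b != None & c != None].
Proof.
rewrite !dim_cons_eq0 dim_eq0; set e := [forall i, _]; have -> : e.
  by apply/forallP=> -[].
by rewrite andbT.
Qed.

Lemma in_base b w : (w \in base b) =
  [|| w == word3 (Some false) (Some true) None,
      w == word3 None (Some false) (Some (~~ b)),
      w == word3 (Some true) None (Some b),
      w == word3 (Some false) (Some false) (Some b) |
      w == word3 (Some true) (Some true) (Some (~~ b))].
Proof. by rewrite !inE -!orbA. Qed.

Lemma exact_cover_base b : exact_cover (base b).
Proof.
split=> [x|x v w].
  have [p [q [r ->]]] := point3P x.
  have cov w : point3 p q r \in subcube w -> w \in base b ->
      covered (base b) (point3 p q r) by move=> xw wF; apply/coveredP; exists w.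
  (* Spelling out the five memberships leaves a boolean check over the values of [b], [p], [q],
     [r]. *)
  suff: [|| point3 p q r \in subcube (word3 (Some false) (Some true) None),
            point3 p q r \in subcube (word3 None (Some false) (Some (~~ b))),
            point3 p q r \in subcube (word3 (Some true) None (Some b)),
            point3 p q r \in subcube (word3 (Some false) (Some false) (Some b)) |
            point3 p q r \in subcube (word3 (Some true) (Some true) (Some (~~ b)))].
    by case/orP=> [xw|/or4P[] xw]; apply: (cov _ xw); rewrite in_base eqxx ?orbT.
  by rewrite !mem_word3; case: b p q r {cov} => [] [] [] [].
have [p [q [r ->]]] := point3P x.
rewrite !in_base => /orP[|/or4P[]] /eqP-> /orP[|/or4P[]] /eqP-> //; rewrite !mem_word3;
by case: b p q r => [] [] [] [].
Qed.

(** Whether a word of [base b] lies in [G] can be read off at any of its points, so the claim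
    becomes a finite check over the 27 candidate subcubes for each [b]. *)
Lemma indecomposable_base b : indecomposable (base b).
Proof.
move=> G v sG; have [p [q [r ->]]] := word3P v => covG.
have memG w x : w \in base b -> x \in subcube w ->
    (w \in G) = (x \in subcube (word3 p q r)).
  move=> wF xw; rewrite covG; apply/idP/coveredP => [wG|[u uG xu]].
    by exists w.
  have [_ uniF] := exact_cover_base b.
  by rewrite (uniF x w u wF (subsetP sG u uG) xw xu).
have memG3 w i j k : w \in base b -> point3 i j k \in subcube w ->
    (w \in G) = [&& (p == None) || (p == Some i), (q == None) || (q == Some j) &
                  (r == None) || (r == Some k)].
  by move=> wF xw; rewrite -mem_word3; apply: memG.
pose w1 := word3 (Some false) (Some true) None.
pose w2 := word3 None (Some false) (Some (~~ b)).
pose w3 := word3 (Some true) None (Some b).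
pose w4 := word3 (Some false) (Some false) (Some b).
pose w5 := word3 (Some true) (Some true) (Some (~~ b)).
have baseE w : (w \in base b) = [|| w == w1, w == w2, w == w3, w == w4 | w == w5].
  exact: in_base.
have [b1 b2 b3 b4 b5] :
    [/\ w1 \in base b, w2 \in base b, w3 \in base b, w4 \in base b & w5 \in base b].
  by rewrite !baseE !eqxx ?orbT.
(* Either all five words are in [G] or exactly one is; the last disjunct groups the two point
   words. *)
have : [|| [&& w1 \in G, w2 \in G, w3 \in G, w4 \in G & w5 \in G],
  [&& w1 \in G, w2 \notin G, w3 \notin G, w4 \notin G & w5 \notin G],
  [&& w1 \notin G, w2 \in G, w3 \notin G, w4 \notin G & w5 \notin G],
  [&& w1 \notin G, w2 \notin G, w3 \in G, w4 \notin G & w5 \notin G] |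
  [&& w1 \notin G, w2 \notin G, w3 \notin G, (w4 \in G) (+) (w5 \in G)
    & ~~ ((w4 \in G) && (w5 \in G))]].
  (* These are the second endpoints of the three edges. Compared with the first endpoints used in
     the rewrites below, they exclude subcubes that cut an edge. *)
  have := memG3 _ false true true b1; have := memG3 _ true false (~~ b) b2.
  have := memG3 _ true true b b3.
  rewrite (memG3 w1 false true false) // ?mem_word3 //.
  rewrite (memG3 w2 false false (~~ b)) // ?mem_word3 ?eqxx ?orbT //.
  rewrite (memG3 w3 true false b) // ?mem_word3 ?eqxx ?orbT //.
  rewrite (memG3 w4 false false b) // ?mem_word3 ?eqxx ?orbT //.
  rewrite (memG3 w5 true true (~~ b)) // ?mem_word3 ?eqxx ?orbT //.
  clear; move=> /(_ isT) + /(_ isT) + /(_ isT).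
  by case: p q r b => [[]|] [[]|] [[]|] [].
have single w : w \in G -> {in base b, forall u, u \in G -> u = w} ->
    G = base b \/ exists w, G = [set w].
  move=> wG Gw; right; exists w; apply/setP=> u; apply/idP/set1P => [uG|-> //].
  by apply: Gw => //; apply: (subsetP sG).
case/orP=> [/and5P[g1 g2 g3 g4 g5]|].
  left; apply/eqP; rewrite eqEsubset sG; apply/subsetP=> w.
  by rewrite baseE => /orP[|/or4P[]] /eqP->.
case/or4P=> /and5P[].
- move=> g /negPf h2 /negPf h3 /negPf h4 /negPf h5; apply: (single w1) => // u.
  by rewrite baseE => /orP[|/or4P[]] /eqP-> //; rewrite ?h2 ?h3 ?h4 ?h5.
- move=> /negPf h1 g /negPf h3 /negPf h4 /negPf h5; apply: (single w2) => // u.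
  by rewrite baseE => /orP[|/or4P[]] /eqP-> //; rewrite ?h1 ?h3 ?h4 ?h5.
- move=> /negPf h1 /negPf h2 g /negPf h4 /negPf h5; apply: (single w3) => // u.
  by rewrite baseE => /orP[|/or4P[]] /eqP-> //; rewrite ?h1 ?h2 ?h4 ?h5.
move=> /negPf h1 /negPf h2 /negPf h3; case h4: (w4 \in G); case h5: (w5 \in G) => // _ _.
  apply: (single w4) => // u.
  by rewrite baseE => /orP[|/or4P[]] /eqP-> //; rewrite ?h1 ?h2 ?h3 ?h5.
apply: (single w5) => // u.
by rewrite baseE => /orP[|/or4P[]] /eqP-> //; rewrite ?h1 ?h2 ?h3 ?h4.
Qed.

Lemma good_pair_base : good_pair 2 base.
Proof.
split=> [b|b|b|w|].
- exact: exact_cover_base.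
- exact: indecomposable_base.
- have -> : [set w in base b | dim w == 0] =
      [set word3 (Some false) (Some false) (Some b);
           word3 (Some true) (Some true) (Some (~~ b))].
    apply/setP=> w; have [p [q [r ->]]] := word3P w.
    by rewrite inE in_base !inE !eq_word3 dim_word3; case: p q r b => [[]|] [[]|] [[]|] [].
  by rewrite cards2 eq_word3.
- have [p [q [r ->]]] := word3P w.
  by rewrite !inE !eq_word3 dim_word3; case: p q r => [[]|] [[]|] [[]|].
exists (word3 (Some false) (Some true) None).
by rewrite !inE !eqxx.
Qed.

(** The base pair has two points in each member, and each stacking doubles that number. *)
Lemma good_pair_exists k : exists F : bool -> {set word k.+3}, good_pair (2 ^ k.+1) F.
Proof.
elim: k => [|k [F gF]]; first by exists base; apply: good_pair_base.
by eexists; rewrite expnS; apply: good_pair_merge; exact: gF.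
Qed.

Theorem theorem2p36 (n : nat) (hn : 3 <= n) :
  exists F : {set word n},
    [/\ subcube_partition F,
        irreducible F &
        #|[set w in F | dim w == 0]| = 2 ^ (n - 2)].
Proof.
case: n hn => [|[|[|k]]] // _; have [F [exF indF cF _ _]] := good_pair_exists k.
(* Either member of the pair would serve; the other one carries the induction. *)
exists (F false); split; last by rewrite cF subn2.
  exact: exact_cover_partition.
exact: indecomposable_irreducible.
Qed.
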